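(* Let $m$ and $n$ be positive odd integers. The number of group homomorphisms from $D_m$ into $D_n$ is $$1+n\left(\sum_{k\mid \gcd(m,n)}\phi(k)\right),$$ where the sum runs over the positive divisors $k$ of $\gcd(m,n)$.
   Context: For a positive integer $l$, $D_l$ denotes the finite (dihedral) group, of order $2l$, generated by two generators $r_l$ and $f_l$ subject to the relations $r_l^l = e = f_l^2$ and $r_l f_l = f_l r_l^{-1}$. $\phi$ denotes Euler's totient function. Homomorphisms are not required to be injective. *)

(* Defs.v *)
From HB Require Import structures.
From mathcomp Require Import all_boot all_fingroup zmodp all_solvable.

Set Implicit Arguments.
Unset Strict Implicit.
Unset Printing Implicit Defensive.

Local Open Scope group_scope.

(* The type 'D_(l.*2) of extremal.v is the dihedral group of order 2l only    *)
(* for l > 1 (its cyclic part is 'Z_l, and 'Z_1 has order 2). We therefore    *)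
(* characterise D_l by its order and its presentation, for every l > 0.       *)
Definition is_dihedral (l : nat) (gT : finGroupType) : Prop :=
  #|gT| = (2 * l)%N /\
  [set: gT] \isog Grp (r : f : r ^+ l = f ^+ 2 = 1, r * f = f * r^-1).

Definition homs (gT rT : finGroupType) : {set {ffun gT -> rT}} :=
  [set h : {ffun gT -> rT} | morphic [set: gT] h].

Lemma is_dihedral_exists (l : nat) : 0 < l -> exists gT, is_dihedral l gT.
Proof.
case: l => [|[|l]] // _.
  exists 'I_2; split; first by rewrite card_ord.
  apply: intro_isoGrp => [|gT G].
    apply/existsP; exists (1, Zp1); rewrite /= !xpair_eqE /=.
    rewrite cycle1 joing1G invg1 mulg1 mul1g !eqxx andbT.
    by apply/eqP/esym/(Zp_cycle 1).
  case/existsP=> -[x y] /= /eqP[defG x1 y2 _].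
  move: x1; rewrite expg1 => x1.
  move: defG; rewrite x1 cycle1 joing1G => defG.
  have dvdy: #[y] %| #[Zp1 : 'I_2] by rewrite order_Zp1 order_dvdn y2.
  rewrite -defG; apply/homgP; rewrite (Zp_cycle 1).
  by exists (eltm_morphism dvdy); rewrite im_eltm.
pose q := l.+2; exists ('D_q.*2)%type; split.
  by rewrite -cardsT (card_dihedral (q := q)) ?mul2n.
have rel (gT : finGroupType) (x y : gT) :
  (x * y == y * x^-1) = (x ^ y == x^-1).
  by rewrite conjgC (inj_eq (mulgI y)).
apply: intro_isoGrp => [|gT G].
  have /isoGrp_hom/existsP[[x y] /=] := @Grp_dihedral q isT.
  rewrite !xpair_eqE => /and4P[defG xq y2 xy].
  by apply/existsP; exists (x, y); rewrite /= !xpair_eqE rel defG xq y2 xy.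
case/existsP=> -[x y] /=; rewrite !xpair_eqE rel => /andP[defG relG].
rewrite (@Grp_dihedral q isT); apply/existsP; exists (x, y).
rewrite /= !xpair_eqE defG.
by move: relG; rewrite -?andbA => /and3P[-> -> ->].
Qed.

(* Main.v *)
(* A dihedral group of order 2l is <r> ><| <f>, so a homomorphism from D_m is *)
(* the same thing as a pair (x, y) of D_n with x^m = y^2 = 1 and x^y = x^-1.  *)
(* As m is odd and every element of D_n outside the rotation subgroup R is an *)
(* involution, x lies in R. If y is in R then y = 1 because n is odd, and     *)
(* then x = 1 because x = x^-1. If y is one of the n reflections, it inverts  *)
(* R, so x is any of the gcd(m, n) solutions of x^m = 1 in R.                 *)
Require Import Defs.
From HB Require Import structures.
From mathcomp Require Import all_boot all_fingroup all_solvable.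

Set Implicit Arguments.
Unset Strict Implicit.
Unset Printing Implicit Defensive.

Local Open Scope group_scope.

(** A homomorphism out of [Dm] is determined by the images of its generators, and any pair in [Dn]
    satisfying the relations occurs ([card_homs_dihedral]). In [Dn] these pairs are (1, 1) and the
    pairs of an m-th root of 1 among the rotations with one of the n reflections
    ([card_dihedral_rel]), hence 1 + n * gcd(m, n) in all. Gauss's identity then rewrites gcd(m, n)
    as a totient sum. *)

Definition dihedral_rel (gT : finGroupType) (l : nat) (x y : gT) : bool :=
  [&& x ^+ l == 1, y ^+ 2 == 1 & x ^ y == x^-1].

(** Together with [x ^+ k = 1] this forces [x = 1], which is how oddness restricts the admissible
    pairs. *)
Lemma expg_odd_involution (gT : finGroupType) (x : gT) (k : nat) :
  odd k -> x ^+ 2 = 1 -> x ^+ k = x.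
Proof.
by move=> odd_k x2; rewrite -(odd_double_half k) odd_k -mul2n expgD expgM x2
  expg1n mulg1.
Qed.

Lemma dihedral_sdprod (l : nat) (gT : finGroupType) :
  0 < l -> is_dihedral l gT ->
  exists r f : gT, [/\ #[r] = l, #[f] = 2, r ^ f = r^-1 &
                       <[r]> ><| <[f]> = [set: gT]].
Proof.
move=> l_gt0 [oG /isoGrp_hom/existsP[[r f] /=]].
rewrite !xpair_eqE => /and4P[/eqP defG rl f2 /eqP rf].
(* Since r * f = f * r ^ f, the relation of the presentation is the conjugation form used in
   [dihedral_rel]. *)
have {}rf : r ^ f = r^-1 by apply: (mulgI f); rewrite -conjgC.
have nRF : <[f]> \subset 'N(<[r]>).
  by rewrite cycle_subG; apply/normP; rewrite -cycleJ rf cycleV.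
have oRF : #|<[r]> * <[f]>| = (2 * l)%N by rewrite -norm_joinEr // defG cardsT.
have le_r : #[r] <= l by rewrite dvdn_leq // order_dvdn.
have le_f : #[f] <= 2 by rewrite dvdn_leq // order_dvdn.
(* The relations only bound the orders of r and f from above; the group order 2l forces equality in
   both bounds, and then a trivial intersection. *)
have le_rf : 2 * l <= #[r] * #[f].
  by rewrite -oRF !orderE mul_cardG leq_pmulr.
have or : #[r] = l.
  apply/eqP; rewrite eqn_leq le_r -(leq_pmul2l (isT : 0 < 2)) /=.
  by rewrite (leq_trans le_rf) // mulnC leq_mul.
have of2 : #[f] = 2.
  apply/eqP; rewrite eqn_leq le_f -(leq_pmul2r l_gt0) /=.
  by rewrite (leq_trans le_rf) // mulnC leq_mul.
exists r, f; split=> //; rewrite -defG sdprodEY //.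
by apply: cardMg_TI; rewrite oRF -!orderE or of2 mulnC.
Qed.

Section Rotations.

Variables (gT : finGroupType) (n : nat) (r f : gT).
Hypotheses (or : #[r] = n) (of2 : #[f] = 2) (rf : r ^ f = r^-1).
Hypothesis defG : <[r]> ><| <[f]> = [set: gT].

(** Such a y is r^i * f. As f inverts r^i, the two rotations in y^2 cancel; as r^i commutes with all
    rotations, y conjugates them as f does. *)
Lemma reflectionP (y : gT) : y \notin <[r]> ->
  y ^+ 2 = 1 /\ {in <[r]>, forall x, x ^ y = x^-1}.
Proof.
have xf i : (r ^+ i) ^ f = (r ^+ i)^-1 by rewrite conjXg rf expVgn.
have f2 : f ^+ 2 = 1 by rewrite -of2 expg_order.
have : y \in <[r]> * <[f]> by rewrite (sdprodW defG) inE.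
case/mulsgP=> a b /cycleP[i ->] /cyclePmin[[|[|k]]].
- by move=> _ -> -> /negP[]; rewrite mulg1 mem_cycle.
- rewrite expg1 => _ -> -> _; split=> [|x /cycleP[j ->]].
    rewrite expgS expg1 {2}(conjgC (r ^+ i) f) xf.
    by rewrite mulgA -(mulgA _ f f) -[f * f]/(f ^+ 2) f2 mulg1 mulgV.
  by rewrite conjgM (conjgE (r ^+ j)) (commuteX2 j i (commute_refl r)) mulKg xf.
by rewrite of2.
Qed.

Lemma odd_exp_rotation (m : nat) (x : gT) : odd m -> x ^+ m = 1 -> x \in <[r]>.
Proof.
move=> odd_m xm; apply: contraT => Rx; have [x2 _] := reflectionP Rx.
by move: Rx; rewrite -(expg_odd_involution odd_m x2) xm group1.
Qed.

(** The roots form the subgroup of order g = gcd(m, n) generated by r^(n/g): in a cyclic group,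
    inclusion of subgroups is divisibility of their orders. *)
Lemma card_rotation_roots (m : nat) : 0 < n ->
  #|[set x in <[r]> | x ^+ m == 1]| = gcdn m n.
Proof.
move=> n_gt0; set g := gcdn m n; have g_n : g %| #[r] by rewrite or dvdn_gcdr.
have os : #[r ^+ (n %/ g)] = g.
  rewrite orderXdiv or ?dvdn_div ?dvdn_gcdr //.
  by rewrite divnA ?dvdn_gcdr // mulKn.
rewrite -[RHS]os orderE; congr #|pred_of_set _|; apply/setP=> x; rewrite inE.
apply/andP/idP => [[Rx xm] | sx].
  rewrite -cycle_subG -(@cardSg_cyclic _ <[r]>) ?cycle_cyclic ?cycle_subG //;
    last exact: mem_cycle.
  by rewrite -!orderE os dvdn_gcd order_dvdn xm -or order_dvdG.
have Rx : x \in <[r]> by apply: subsetP sx; rewrite cycle_subG mem_cycle.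
split=> //; rewrite -order_dvdn (dvdn_trans _ (dvdn_gcdl m n)) //.
by rewrite -/g -os order_dvdG.
Qed.

Lemma card_dihedral_rel (m : nat) : odd m -> odd n ->
  #|[set p : gT * gT | dihedral_rel m p.1 p.2]| = (1 + n * gcdn m n)%N.
Proof.
move=> odd_m odd_n; have n_gt0 := odd_gt0 odd_n.
have -> : [set p : gT * gT | dihedral_rel m p.1 p.2] =
    (1, 1) |: setX [set x in <[r]> | x ^+ m == 1] (~: <[r]>).
  apply/setP=> -[x y]; rewrite !inE xpair_eqE /dihedral_rel /=.
  apply/and3P/idP => [[/eqP xm /eqP y2 /eqP xy] | ].
    rewrite (odd_exp_rotation odd_m xm) xm eqxx /=.
    have [Ry | _] := boolP (y \in <[r]>); last by rewrite orbT.
    have yn : y ^+ n = 1 by apply/eqP; rewrite -order_dvdn -or order_dvdG.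
    have y1 : y = 1 by rewrite -(expg_odd_involution odd_n y2).
    move: xy; rewrite y1 conjg1 => xV.
    have x2 : x ^+ 2 = 1 by rewrite expgS expg1 {2}xV mulgV.
    by rewrite -(expg_odd_involution odd_m x2) xm !eqxx.
  case/orP=> [/andP[/eqP-> /eqP->] | /andP[/andP[Rx xm] Ry]].
    by rewrite !expg1n conj1g invg1 eqxx.
  by have [y2 yV] := reflectionP Ry; rewrite xm y2 yV ?eqxx.
rewrite cardsU1 !inE group1 andbF /= cardsX card_rotation_roots // mulnC.
(* The reflections number n, as the n rotations are half of the group. *)
congr (_ + _ * _)%N; apply: (@addnI #|<[r]>|).
by rewrite cardsC -cardsT -(sdprod_card defG) -!orderE or of2 muln2 addnn.
Qed.

Lemma card_homs_dihedral (rT : finGroupType) :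
  #|homs gT rT| = #|[set p : rT * rT | dihedral_rel n p.1 p.2]|.
Proof.
have rf_rel : dihedral_rel n r f.
  by rewrite /dihedral_rel -or expg_order -of2 expg_order rf !eqxx.
pose ev (h : {ffun gT -> rT}) := (h r, h f).
have homP h : h \in homs gT rT ->
    exists phi : {morphism [set: gT] >-> rT}, h =1 phi.
  by rewrite inE => hM; exists (morphm_morphism hM).
(* Every element is r^i * f^j, so the values at r and f determine the morphism. *)
have ev_inj : {in homs gT rT &, injective ev}.
  move=> h k /homP[phi hE] /homP[psi kE] [eq_r eq_f]; apply/ffunP=> z.
  have : z \in <[r]> * <[f]> by rewrite (sdprodW defG) inE.
  case/mulsgP=> _ _ /cycleP[i ->] /cycleP[j ->] ->; rewrite hE kE.
  by rewrite !morphM ?morphX ?inE // -!hE -!kE eq_r eq_f.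
rewrite -(card_in_imset ev_inj); apply: eq_card => -[x y]; rewrite inE /=.
apply/imsetP/idP => [[h /homP[phi hE] [-> ->]] | /and3P[xn y2 /eqP xy]].
  rewrite /dihedral_rel !hE; case/and3P: rf_rel => /eqP rn /eqP f2 /eqP fV.
  by rewrite -!morphX -?morphJ -?morphV ?inE // rn f2 fV !morph1 !eqxx.
have dx : #[x] %| #[r] by rewrite or order_dvdn.
have dy : #[y] %| #[f] by rewrite of2 order_dvdn.
(* The maps r -> x and f -> y on the two cyclic factors respect the conjugation action, so they glue
   to a morphism on the semidirect product. *)
have actf : {in <[r]> & <[f]>, morph_act 'J 'J (eltm dx) (eltm dy)}.
  move=> _ _ /cycleP[i ->] /cyclePmin[[|[|k]] lt_k ->] /=.
  - by rewrite !expg0 morph1 !conjg1.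
  - rewrite expg1 eltm_id conjXg rf expVgn morphV ?mem_cycle //= eltmE.
    by rewrite conjXg xy expVgn.
  - by rewrite of2 in lt_k.
pose h := [ffun z => sdprodm defG actf z]; exists h.
  by rewrite inE; apply/morphicP=> a b _ _; rewrite !ffunE morphM ?inE.
by rewrite /ev !ffunE sdprodmEl ?sdprodmEr ?cycle_id //= !eltm_id.
Qed.

End Rotations.

(** Gauss's identity, moved from the sum over all d <= k dividing k to the list [divisors k]. *)
Lemma sum_totient_divisors (k : nat) : 0 < k ->
  (\sum_(d <- divisors k) totient d)%N = k.
Proof.
move=> k_gt0; rewrite -[RHS]sum_totient_dvd -(big_mkord (fun d => d %| k)).
rewrite -[RHS]big_filter; apply: perm_big; apply: uniq_perm.
- exact: divisors_uniq.
- by rewrite filter_uniq ?iota_uniq.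
move=> d; rewrite mem_filter mem_index_iota -dvdn_divisors //= ltnS.
by case: (boolP (d %| k)) => // /(dvdn_leq k_gt0) ->.
Qed.

Local Close Scope group_scope.

Theorem theorem1 (m n : nat) (Dm Dn : finGroupType) :
  0 < m -> odd m -> 0 < n -> odd n ->
  is_dihedral m Dm -> is_dihedral n Dn ->
  #|homs Dm Dn| = 1 + n * (\sum_(k <- divisors (gcdn m n)) totient k).
Proof.
move=> m_gt0 odd_m n_gt0 odd_n dihDm dihDn.
have [r [f [or of2 rf defDm]]] := dihedral_sdprod m_gt0 dihDm.
have [s [g [os og sg defDn]]] := dihedral_sdprod n_gt0 dihDn.
(* The generators of the source reduce the problem to counting pairs; those of the target carry out
   the count. *)
rewrite (card_homs_dihedral or of2 rf defDm).
rewrite (card_dihedral_rel os og sg defDn odd_m odd_n).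
by rewrite sum_totient_divisors // gcdn_gt0 m_gt0.
Qed.
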